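(* Let $k\ge1$ and suppose that for $i=1,\dots,k$ $$4\left(a_{i+1}\frac{c_i}{c_{i+1}}-a_i\right)\left(a_i-a_{i-1}\frac{c_{i-1}}{c_i}\right)>(b_i-b_{i-1})^2$$ and $$\frac{a_{i+1}}{a_i}>\frac{c_{i+1}}{c_i}.$$ Then $T_2(p_k)=p_k^2(x)-p_{k-1}(x)p_{k+1}(x)>0$ for all $x\in\mathbb{R}$.
   Context: The polynomials $p_k=p_k(x)$ are defined by $p_{-1}=0$, $p_0=1$ and $$\frac{a_k}{c_k}\,p_k=(x-b_{k-1})p_{k-1}-a_{k-1}c_{k-1}\,p_{k-2},\qquad k\ge1,$$ where $b_k\in\mathbb{R}$, $a_k>0$ for $k\ge1$, $c_k>0$ for all $k$, and $a_0=0$ by convention. *)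

(* Defs.v *)
From HB Require Import structures.
From mathcomp Require Import all_boot all_order all_algebra.
From mathcomp Require Import reals.

Set Implicit Arguments.
Unset Strict Implicit.
Unset Printing Implicit Defensive.
Import Order.TTheory GRing.Theory Num.Theory.
Local Open Scope ring_scope.

(* The family is indexed by int so that p (-1) is available; only its values
   at indices >= -1 are constrained. *)
Definition three_term_system (R : realType) (a b c : nat -> R)
    (p : int -> {poly R}) : Prop :=
  [/\ p (-1) = 0,
      p 0 = 1 &
      forall k : nat, (1 <= k)%N ->
        (a k / c k) *: p k%:Z =
          ('X - (b k.-1)%:P) * p (k%:Z - 1)
          - (a k.-1 * c k.-1) *: p (k%:Z - 2)].

Definition T2 (R : realType) (p : int -> {poly R}) (k : int) : {poly R} :=
  p k ^+ 2 - p (k - 1) * p (k + 1).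

(* Main.v *)
Require Import Defs.
From HB Require Import structures.
From mathcomp Require Import all_boot all_order all_algebra.
From mathcomp Require Import reals.
From mathcomp Require Import zify ring lra.

(** Put [A_k = a_k / c_k] and [D_k = a_k * c_k].  Writing out
    [A_(k+1) * T2 (p_k)] with the recurrence for [p_(k+1)], and then trading
    [(x - b_(k-1)) * p_(k-1)] for [A_k * p_k + D_(k-1) * p_(k-2)], removes [x]:

      A_(k+1) T2(p_k) = (A_(k+1) - A_k) p_k^2 + (b_k - b_(k-1)) p_k p_(k-1)
                        + (D_k - D_(k-1)) p_(k-1)^2 + D_(k-1) T2(p_(k-1)).

    The first three terms form a quadratic form in [(p_k, p_(k-1))]; since
    [c_k (A_(k+1) - A_k) = a_(k+1) c_k / c_(k+1) - a_k] and
    [(D_k - D_(k-1)) / c_k = a_k - a_(k-1) c_(k-1) / c_k], the two hypotheses of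
    the theorem say exactly that it is positive definite.  Induction on [k]
    starts from [T2(p_0) = 1].  In the step [D_(k-1) T2(p_(k-1)) >= 0], and
    the form is evaluated away from the origin, because [p_k] and [p_(k-1)]
    vanishing together would give [T2(p_(k-1)) = 0].  Hence [T2(p_k) > 0].

    The argument is pointwise in [x], so [turan_pos] runs it on real sequences;
    [turan_rec] is the identity above and [quad_form_gt0] the positivity of the
    form. *)

Set Implicit Arguments.
Unset Strict Implicit.
Unset Printing Implicit Defensive.
Import Order.TTheory GRing.Theory Num.Theory.
Local Open Scope ring_scope.

(** Complete the square after multiplying by [4 * r]:
    [4 r Q = (2 r u + s v)^2 + (4 r t - s^2) v^2]. *)
Lemma quad_form_gt0 (R : realFieldType) (r s t u v : R) :
  0 < r -> s ^+ 2 < 4 * r * t -> (u != 0) || (v != 0) ->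
  0 < r * u ^+ 2 + s * u * v + t * v ^+ 2.
Proof.
move=> r_gt0 disc uv_neq0; rewrite -(pmulr_rgt0 _ (_ : 0 < 4 * r)); last by lra.
have -> : 4 * r * (r * u ^+ 2 + s * u * v + t * v ^+ 2)
        = (2 * r * u + s * v) ^+ 2 + (4 * r * t - s ^+ 2) * v ^+ 2 by ring.
have [v0|v_neq0] := eqVneq v 0.
  move: uv_neq0; rewrite v0 eqxx orbF => u_neq0.
  rewrite mulr0 addr0 expr0n mulr0 addr0 exprn_even_gt0 //=.
  by rewrite !mulf_neq0 ?pnatr_eq0 // gt_eqF.
by rewrite ltr_wpDl ?sqr_ge0 // mulr_gt0 ?subr_gt0 // exprn_even_gt0.
Qed.

(** Here [q0, q1, q2, q3] are four consecutive terms, [A1, A2], [b0, b1] and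
    [D0, D1] the coefficients of the two recurrences that link them. *)
Lemma turan_rec (R : comPzRingType) (x A1 A2 b0 b1 D0 D1 q0 q1 q2 q3 : R) :
  A1 * q2 = (x - b0) * q1 - D0 * q0 ->
  A2 * q3 = (x - b1) * q2 - D1 * q1 ->
  A2 * (q2 ^+ 2 - q1 * q3) =
    (A2 - A1) * q2 ^+ 2 + (b1 - b0) * q2 * q1 + (D1 - D0) * q1 ^+ 2
    + D0 * (q1 ^+ 2 - q0 * q2).
Proof.
move=> rec1 rec2.
have -> : A2 * (q2 ^+ 2 - q1 * q3) = A2 * q2 ^+ 2 - q1 * (A2 * q3) by ring.
have -> : (A2 - A1) * q2 ^+ 2 = A2 * q2 ^+ 2 - q2 * (A1 * q2) by ring.
rewrite rec1 rec2; ring.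
Qed.

(** The sequence is shifted, [q n] standing for the value of [p_(n-1)], so that
    both initial values are at natural indices; [A] and [D] keep the indexing
    of the coefficients. *)
Lemma turan_pos (R : realFieldType) (A D b q : nat -> R) (x : R) (k : nat) :
    q 0%N = 0 -> q 1%N = 1 ->
    (forall n, A n.+1 * q n.+2 = (x - b n) * q n.+1 - D n * q n) ->
    (forall n, 0 < A n.+1) -> (forall n, 0 <= D n) ->
    (forall n, (n < k)%N -> A n.+1 < A n.+2) ->
    (forall n, (n < k)%N ->
       (b n.+1 - b n) ^+ 2 < 4 * (A n.+2 - A n.+1) * (D n.+1 - D n)) ->
  0 < q k.+1 ^+ 2 - q k * q k.+2.
Proof.
move=> q0 q1 rec A_gt0 D_ge0; elim: k => [|k IHk] A_incr disc.
  by rewrite q0 q1 mul0r subr0 expr1n ltr01.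
have turan_gt0 : 0 < q k.+1 ^+ 2 - q k * q k.+2.
  by apply: IHk => n lt_nk; [apply: A_incr | apply: disc]; apply: ltnW.
rewrite -(pmulr_rgt0 _ (A_gt0 k.+1)) (turan_rec (rec k) (rec k.+1)).
rewrite ltr_wpDr ?(mulr_ge0 (D_ge0 k) (ltW turan_gt0)) //.
apply: quad_form_gt0; rewrite ?subr_gt0 ?A_incr ?disc //.
apply: contraLR turan_gt0; rewrite negb_or !negbK => /andP[/eqP-> /eqP->].
by rewrite expr0n mulr0 subr0 ltxx.
Qed.

Theorem theorem5 (R : realType) (a b c : nat -> R) (p : int -> {poly R})
  (a0 : a 0%N = 0)
  (a_gt0 : forall i : nat, (1 <= i)%N -> 0 < a i)
  (c_gt0 : forall i : nat, 0 < c i)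
  (p_def : three_term_system a b c p)
  (k : nat) (k_ge1 : (1 <= k)%N)
  (discr : forall i : nat, (1 <= i <= k)%N ->
     4 * (a i.+1 * (c i / c i.+1) - a i)
       * (a i - a i.-1 * (c i.-1 / c i)) > (b i - b i.-1) ^+ 2)
  (growth : forall i : nat, (1 <= i <= k)%N ->
     a i.+1 / a i > c i.+1 / c i) :
  forall x : R, 0 < (T2 p k%:Z).[x].
Proof.
move=> x; have [pN1 p0 prec] := p_def.
pose q n := (p (n%:Z - 1)).[x].
have -> : (T2 p k%:Z).[x] = q k.+1 ^+ 2 - q k * q k.+2.
  rewrite /T2 /q !hornerE.
  have -> : k.+1%:Z - 1 = k%:Z by lia.
  by have -> : k.+2%:Z - 1 = k%:Z + 1 by lia.
apply: (@turan_pos _ (fun n => a n / c n) (fun n => a n * c n) b q x).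
- by rewrite /q sub0r pN1 horner0.
- by rewrite /q subrr p0 hornerC.
- move=> n; have /(congr1 (horner^~ x)) := prec n.+1 isT.
  rewrite /q /= !hornerE.
  have -> : n.+2%:Z - 1 = n.+1%:Z by lia.
  by have -> : n.+1%:Z - 2 = n%:Z - 1 by lia.
- by move=> n; rewrite divr_gt0 ?a_gt0.
- by case=> [|n]; rewrite ?a0 ?mul0r // mulr_ge0 // ltW // a_gt0.
- move=> n lt_nk; have := growth n.+1 lt_nk.
  have a1 := a_gt0 n.+1 isT; have c1 := c_gt0 n.+1; have c2 := c_gt0 n.+2.
  by rewrite ltr_pdivlMr // mulrAC ltr_pdivrMr // ltr_pdivrMr // mulrAC
    ltr_pdivlMr // [c n.+2 * _]mulrC.
- move=> n lt_nk; have := discr n.+1 lt_nk; rewrite /=.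
  (* the factors [c n.+1] and [(c n.+1)^-1] of the two differences cancel *)
  suff -> : 4 * (a n.+2 / c n.+2 - a n.+1 / c n.+1)
              * (a n.+1 * c n.+1 - a n * c n)
          = 4 * (a n.+2 * (c n.+1 / c n.+2) - a n.+1)
              * (a n.+1 - a n * (c n / c n.+1)) by [].
  by field; rewrite !gt_eqF.
Qed.
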